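(* Let $\Phi$ be the oversampled discrete Fourier transform on $\mathcal{M}$. Let $x_0\in\mathbb{C}^n$, $n=|\mathcal M|$, be an object of rank $\ge 2$, let $\ell\ge 2$, and let at least one of the masks $\mu_j$, $j=1,\dots,\ell$, be independently and continuously distributed on the unit circle. Let $$A^*=c\begin{bmatrix}\Phi\,\mathrm{diag}\{\mu_1\}\\ \vdots\\ \Phi\,\mathrm{diag}\{\mu_\ell\}\end{bmatrix}$$ be isometric (i.e. $AA^*=I$), and let $$B:=A\,\mathrm{diag}\{\omega_0\},\qquad \omega_0:=\frac{A^*x_0}{|A^*x_0|}.$$ Then with probability one: for $u\in\mathbb{C}^n$ with $\|u\|=1$, $$\|\Im(B^*u)\|=1\quad\text{if and only if}\quad u=\pm\, i\,x_0/\|x_0\|,$$ and hence $$\lambda_2:=\max_{0\ne u\in\mathbb{C}^n,\ u\perp ix_0}\|u\|^{-1}\|\Im(B^*u)\|<1.$$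
   Context: Let $d\ge2$, $\mathcal M=\{(m_1,\dots,m_d)\in\mathbb Z^d:0\le m_j\le M_j\}$, $\widetilde{\mathcal M}=\{(m_1,\dots,m_d)\in\mathbb{Z}^d:-M_j\le m_j\le M_j\}$ and $\mathcal L=\{(w_1,\dots,w_d): w_j\in\{0,\tfrac1{2M_j+1},\dots,\tfrac{2M_j}{2M_j+1}\}\}$, so $|\mathcal L|=|\widetilde{\mathcal M}|$. The oversampled DFT $\Phi\in\mathbb{C}^{|\widetilde{\mathcal M}|\times|\mathcal M|}$ is the matrix with entries $e^{-2\pi i\,\mathbf n\cdot\mathbf w}$, $\mathbf w\in\mathcal L$, $\mathbf n\in\mathcal M$. Objects are functions $f$ on $\mathcal M$, identified with vectors $x_0\in\mathbb{C}^n$, $n=|\mathcal M|$. $x_0$ has rank $\ge2$ if the convex hull of its support in $\mathbb{Z}^d$ is of dimension two or higher. A (phase) mask $\mu$ is a function on $\mathcal M$ with $|\mu(\mathbf n)|=1$ for all $\mathbf n$; it is independently and continuously distributed on the unit circle if $\mu(\mathbf n)=e^{i\phi(\mathbf n)}$ with $\phi(\mathbf n)$, $\mathbf n\in\mathcal M$, independent continuous real-valued random variables. $c$ is a normalizing constant. $|\cdot|$ and division are component-wise; a component of $A^*x_0/|A^*x_0|$ is set to $1$ where $A^*x_0$ vanishes. $\Im$ is component-wise; $\perp$ is with respect to the real inner product $\langle u,v\rangle=\Re(u^*v)$.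
   Formalization: The independently and continuously distributed mask is also assumed independent of the other masks (which may be deterministic or random); without this the claim fails, e.g. when all masks coincide. *)

(* Defs.v *)
From mathcomp Require Export all_boot all_order all_algebra.
From mathcomp Require Export complex.
From mathcomp Require Export all_classical all_reals all_analysis.

Set Implicit Arguments.
Unset Strict Implicit.
Unset Printing Implicit Defensive.

Import Order.TTheory GRing.Theory Num.Theory.
Import numFieldNormedType.Exports.

Local Open Scope classical_set_scope.
Local Open Scope ring_scope.
Local Open Scope complex_scope.
Local Open Scope sesquilinear_scope.

Section ComplexVectors.
Context {R : realType}.
Local Notation C := R[i].

Definition expi (t : R) : C := cos t +i* sin t.

(* Euclidean norm; the library norm on matrices is the sup norm. *)
Definition l2norm m (u : 'cV[C]_m) : R :=
  Num.sqrt (\sum_k (Normc.normc (u k 0)) ^+ 2).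

Definition Imvec m (u : 'cV[C]_m) : 'cV[C]_m :=
  map_mx (fun z : C => (complex.Im z)%:C) u.

Definition rdot m (u v : 'cV[C]_m) : R := complex.Re ((u^t* *m v) 0 0).

Definition phase (z : C) : C := if z == 0 then 1 else z / `|z|.

Definition is_maximum (S : set R) (r : R) : Prop := S r /\ ubound S r.

End ComplexVectors.

Section Lattice.
Context {d : nat}.

(* The boxes {0 <= m_j <= M_j} and {0 <= k_j <= 2 M_j}; the latter indexes the
   frequencies w_j = k_j / (2 M_j + 1). *)
Definition box (M : 'I_d -> nat) : finType := {dffun forall j : 'I_d, 'I_(M j).+1}.
Definition freq_box (M : 'I_d -> nat) : finType :=
  {dffun forall j : 'I_d, 'I_(2 * M j).+1}.

Definition freq {R : realType} (M : 'I_d -> nat) (k : freq_box M) (j : 'I_d) : R :=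
  (k j)%:R / (2 * M j).+1%:R.

Definition box_point {R : realType} (M : 'I_d -> nat) (n : box M) : 'rV[R]_d :=
  \row_j (n j)%:R.

End Lattice.

Section Rank.
Context {R : realType} {d : nat}.

Definition convex_hull (S : set 'rV[R]_d) : set 'rV[R]_d :=
  smallest (@convex_set R 'rV[R]_d) S.

(* Largest k such that S contains k + 1 affinely independent points. *)
Definition affine_dim (S : set 'rV[R]_d) : nat :=
  (\max_(k < d.+1 | `[< exists (p : 'rV[R]_d) (X : 'M[R]_(k, d)),
      [/\ S p, forall i, S (p + row i X)%R & row_free X] >]) k)%N.

Definition support_points (M : 'I_d -> nat) (x : 'cV[R[i]]_#|box M|) :
    set 'rV[R]_d :=
  [set box_point (enum_val k) | k in [set k | x k 0 != 0]].

Definition object_rank (M : 'I_d -> nat) (x : 'cV[R[i]]_#|box M|) : nat :=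
  affine_dim (convex_hull (support_points x)).

End Rank.

Section Measurement.
Context {R : realType} {d : nat} (M : 'I_d -> nat).
Local Notation C := R[i].
Local Notation n := #|box M|.
Local Notation N := #|freq_box M|.

Definition oversampled_dft : 'M[C]_(N, n) :=
  \matrix_(k, m) expi (- (2 * pi *
    \sum_(j < d) ((enum_val m : box M) j)%:R * freq (enum_val k) j)).

Definition diag_mask (mu : box M -> C) : 'M[C]_n :=
  diag_mx (\row_m mu (enum_val m)).

Variables (l : nat) (c : C) (mu : 'I_l -> box M -> C).

Definition Astar : 'M[C]_(\sum_(j < l) N, n) :=
  c *: \mxcol_(j < l) (oversampled_dft *m diag_mask (mu j)).

Definition Amat : 'M[C]_(n, \sum_(j < l) N) := Astar^t*.

Variable x0 : 'cV[C]_n.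

Definition omega0 : 'cV[C]_(\sum_(j < l) N) := map_mx phase (Astar *m x0).

Definition Bmat : 'M[C]_(n, \sum_(j < l) N) := Amat *m diag_mx omega0^T.

Definition lambda2_values : set R :=
  [set (l2norm u)^-1 * l2norm (Imvec (Bmat^t* *m u)) | u in
    [set u : 'cV[C]_n | u != 0 /\ rdot u ('i *: x0) = 0]].

End Measurement.

Section RandomMasks.
Context {R : realType} {dO : measure_display} {Om : measurableType dO}.
Variable P : probability Om R.

(* Mutual independence of a finite family of systems of events. *)
Definition mutually_independent (I : finType) (G : I -> set (set Om)) : Prop :=
  forall (J : {set I}) (E : I -> set Om), (forall i, i \in J -> G i (E i)) ->
    P (\bigcap_(i in [set` J]) E i) = (\prod_(i in J) P (E i))%E.

Definition independent_events (G H : set (set Om)) : Prop :=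
  forall E F, G E -> H F -> P (E `&` F) = (P E * P F)%E.

Variable T : finType.

Definition random_phase_mask (mu : Om -> T -> R[i]) : Prop :=
  (forall w n, `|mu w n| = 1) /\
  (forall n, measurable_fun setT (fun w => complex.Re (mu w n)) /\
             measurable_fun setT (fun w => complex.Im (mu w n))).

Definition independently_continuously_distributed (mu : Om -> T -> R[i]) : Prop :=
  exists phi : T -> {RV P >-> R},
    [/\ forall n, continuous (cdf (phi n)),
        mutually_independent
          (fun n => preimage_set_system setT (phi n) measurable)
      & forall w n, mu w n = expi (phi n w)].

(* The sigma-algebra generated by the masks mu j, j in J. *)
Definition sigma_masks (l : nat) (mu : 'I_l -> Om -> T -> R[i]) (J : set 'I_l) :
    set (set Om) :=
  <<s \bigcup_(j in J) \bigcup_n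
       (preimage_set_system setT (fun w => complex.Re (mu j w n)) measurable `|`
        preimage_set_system setT (fun w => complex.Im (mu j w n)) measurable) >>.

End RandomMasks.

(* Main.v *)
(** For a unit vector u, |Im(B^* u)| = 1 forces Re(B^* u) = 0, i.e. for y = -iu
    the products (Phi mu y) conj(Phi mu x0) are real for every mask mu.  Inverting
    the oversampled DFT, the correlations of mu y with mu x0 and of mu x0 with mu y
    agree at every lag.  This persists if y is replaced on the left by a = y - t x0
    and on the right by g = y - conj(t) x0, for any complex t.

    Order the box by an injective additive weight, let s and q be the top and the
    bottom of the support of x0, and choose t with a(s) = 0.  Comparing the
    coefficients at the top lag for two masks mu, mu' and dividing, the ratio
    rho = mu/mu' satisfies rho(top a) rho(bottom g) = rho(s) rho(q).  If one mask is
    random, this fails almost surely unless {top a, bottom g} = {s, q}, for then it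
    prescribes (the square of) one phase in terms of independent data.  So top a = q
    and bottom g = s, and at a third point of the support, which rank >= 2 provides,
    a = g = 0.  Hence t is real, a = g, and a = 0.  If a or g vanishes identically,
    so does the other.  In all cases y is a real multiple of x0. *)

Require Import Defs.
From HB Require Import structures.
From mathcomp Require Import zify ring lra.
Import Order.TTheory GRing.Theory Num.Theory.
Import numFieldNormedType.Exports.

Set Implicit Arguments.
Unset Strict Implicit.
Unset Printing Implicit Defensive.

Local Open Scope classical_set_scope.
Local Open Scope ring_scope.
Local Open Scope sesquilinear_scope.

(** Division by [b] splits off the digit of index 0 as remainder, and the quotient carries the other
    digits, so induction on [d] applies. *)
Lemma digits_inj d b (a c : 'I_d -> nat) :
  (forall i, a i < b)%N -> (forall i, c i < b)%N ->
  (\sum_i a i * b ^ i = \sum_i c i * b ^ i)%N -> a =1 c.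
Proof.
elim: d a c => [|d IH] a c ha hc; first by move=> _ [].
have split (f : 'I_d.+1 -> nat) :
    (\sum_i f i * b ^ i = (\sum_(i < d) f (lift ord0 i) * b ^ i) * b + f ord0)%N.
  rewrite big_ord_recl expn0 muln1 addnC big_distrl /=; congr addn.
  by apply: eq_bigr => i _; rewrite expnSr mulnA.
rewrite !split => /eqP; rewrite eqn_leq => /andP[le1 le2].
have b0 : (0 < b)%N by exact: leq_ltn_trans (ha ord0).
set u := (\sum_(i < d) a (lift ord0 i) * b ^ i)%N in le1 le2.
set v := (\sum_(i < d) c (lift ord0 i) * b ^ i)%N in le1 le2.
have e : (u * b + a ord0 = v * b + c ord0)%N by apply/eqP; rewrite eqn_leq le1.
have euv : u = v.
  have := congr1 (divn^~ b) e.
  by rewrite /= !divnMDl // !divn_small // !addn0.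
have e0 : a ord0 = c ord0 by move: e; rewrite euv => /addnI.
have IHr := IH _ _ (fun i => ha (lift ord0 i)) (fun i => hc (lift ord0 i)) euv.
by move=> i; case: (unliftP ord0 i) => [j ->|->].
Qed.

(** * Cross-correlations on the box and their extreme lags *)

Section Correlation.
Variables (d : nat) (M : 'I_d -> nat).
Implicit Types p q : box M.

(* Base-b digits with b exceeding every M_j: an injective additive functional,
   hence a total order on the box compatible with addition. *)
Definition weight p : nat := (\sum_j p j * (\sum_i M i).+1 ^ j)%N.

Lemma weight_inj : injective weight.
Proof.
move=> p q /digits_inj e; apply/ffunP => j; apply/val_inj/e => {e}j0.
- by rewrite (leq_trans (ltn_ord (p j0))) // ltnS (bigD1 j0) //= leq_addr.
- by rewrite (leq_trans (ltn_ord (q j0))) // ltnS (bigD1 j0) //= leq_addr.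
Qed.

(* p - q = p0 - q0, without subtraction *)
Definition same_diff p q p0 q0 := [forall j, p j + q0 j == p0 j + q j]%N.

Lemma same_diff_refl p q : same_diff p q p q.
Proof. by apply/forallP => j. Qed.

Lemma same_diff_weight p q p0 q0 : same_diff p q p0 q0 ->
  (weight p + weight q0 = weight p0 + weight q)%N.
Proof.
move=> /forallP h; rewrite -!big_split /=; apply: eq_bigr => j _.
by rewrite -!mulnDl (eqP (h j)).
Qed.

Variable C : numClosedFieldType.
Implicit Types a b c e x y : box M -> C.

(** The aperiodic cross-correlation at the lag [p0 - q0], given as a pair of points to avoid
    negative coordinates; conjugation is left to the argument [b]. *)
Definition corr a b p0 q0 := \sum_p \sum_(q | same_diff p q p0 q0) a p * b q.

Definition top_of a p := forall p', a p' != 0 -> (weight p' <= weight p)%N.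
Definition bot_of a p := forall p', a p' != 0 -> (weight p <= weight p')%N.

Lemma exists_top a p : a p != 0 -> exists2 p', a p' != 0 & top_of a p'.
Proof.
move=> ap; case: (@arg_maxnP _ p (fun p => a p != 0) weight ap) => p' ? ?.
by exists p'.
Qed.

Lemma exists_bot a p : a p != 0 -> exists2 p', a p' != 0 & bot_of a p'.
Proof.
move=> ap; case: (@arg_minnP _ p (fun p => a p != 0) weight ap) => p' ? ?.
by exists p'.
Qed.

(** No pair from the two supports has a lag heavier than [pa - pb], and equality fixes the weights
    of both points, hence the points themselves. *)
Lemma corr_top a b pa pb p0 q0 : top_of a pa -> bot_of b pb ->
  (weight pa + weight q0 <= weight p0 + weight pb)%N ->
  corr a b p0 q0 = if same_diff pa pb p0 q0 then a pa * b pb else 0.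
Proof.
move=> ta bb le0.
have z p q : same_diff p q p0 q0 -> (p, q) != (pa, pb) -> a p * b q = 0.
  move=> sd; apply: contraNeq; rewrite mulf_eq0 negb_or => /andP[ap bq].
  have := ta _ ap; have := bb _ bq; have := same_diff_weight sd => h1 h2 h3.
  have /weight_inj -> : weight p = weight pa by lia.
  by have /weight_inj -> : weight q = weight pb by lia.
rewrite /corr (bigD1 pa) //= [X in _ + X]big1 ?addr0; last first.
  move=> p np; apply: big1 => q sd; apply: z => //.
  by apply: contraNneq np => -[->].
case: ifPn => sd.
  rewrite (bigD1 pb) //= big1 ?addr0 // => q /andP[sd' np]; apply: z => //.
  by apply: contraNneq np => -[->].
apply: big1 => q sd'; apply: z => //.
by apply: contraNneq sd => -[<-].
Qed.

Lemma corr_lead a b pa pb : top_of a pa -> bot_of b pb ->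
  corr a b pa pb = a pa * b pb.
Proof. by move=> ta bb; rewrite (corr_top ta bb) // same_diff_refl. Qed.

(** At the heavier of the two extreme lags one correlation is nonzero, and the other can match it
    only with its own extreme term. *)
Lemma corr_lead_eq a b c e pa pb pc pe : corr a b =2 corr c e ->
  top_of a pa -> bot_of b pb -> top_of c pc -> bot_of e pe ->
  a pa != 0 -> b pb != 0 -> c pc != 0 -> e pe != 0 ->
  a pa * b pb = c pc * e pe.
Proof.
move: a b c e pa pb pc pe.
suff wl a b c e pa pb pc pe : corr a b =2 corr c e ->
  top_of a pa -> bot_of b pb -> top_of c pc -> bot_of e pe ->
  a pa != 0 -> b pb != 0 -> (weight pc + weight pb <= weight pa + weight pe)%N ->
  a pa * b pb = c pc * e pe.
  move=> a b c e pa pb pc pe h ta bb tc be an bn cn en.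
  have /orP[le|le] := leq_total (weight pc + weight pb) (weight pa + weight pe).
    exact: wl.
  by apply/esym/wl => //; rewrite addnC.
move=> h ta bb tc be an bn le.
have := h pa pb; rewrite (corr_lead ta bb) (corr_top tc be) //.
case: ifP => // _ /eqP; by rewrite mulf_eq0 (negPf an) (negPf bn).
Qed.

Lemma corr0_lead a b pa pb : (forall p q, corr a b p q = 0) ->
  top_of a pa -> bot_of b pb -> a pa * b pb = 0.
Proof. by move=> h ta bb; rewrite -(corr_lead ta bb). Qed.

Lemma eq_corr a b c e : a =1 c -> b =1 e -> corr a b =2 corr c e.
Proof.
move=> ac be p0 q0; apply: eq_bigr => p _; apply: eq_bigr => q _.
by rewrite ac be.
Qed.

Lemma corrDl a a' b p0 q0 :
  corr (fun p => a p + a' p) b p0 q0 = corr a b p0 q0 + corr a' b p0 q0.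
Proof.
rewrite /corr -big_split /=; apply: eq_bigr => p _.
by rewrite -big_split /=; apply: eq_bigr => q _; rewrite mulrDl.
Qed.

Lemma corrDr a b b' p0 q0 :
  corr a (fun p => b p + b' p) p0 q0 = corr a b p0 q0 + corr a b' p0 q0.
Proof.
rewrite /corr -big_split /=; apply: eq_bigr => p _.
by rewrite -big_split /=; apply: eq_bigr => q _; rewrite mulrDr.
Qed.

Lemma corrZl k a b p0 q0 : corr (fun p => k * a p) b p0 q0 = k * corr a b p0 q0.
Proof.
rewrite /corr big_distrr /=; apply: eq_bigr => p _.
by rewrite big_distrr /=; apply: eq_bigr => q _; rewrite mulrA.
Qed.

Lemma corrZr k a b p0 q0 : corr a (fun p => k * b p) p0 q0 = k * corr a b p0 q0.
Proof.
rewrite /corr big_distrr /=; apply: eq_bigr => p _.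
by rewrite big_distrr /=; apply: eq_bigr => q _; rewrite mulrCA.
Qed.

(* [t] times the correlation of [mu x] with itself is subtracted from both sides. *)
Lemma corr_shift (mu x y : box M -> C) (t : C) :
  corr (fun p => mu p * y p) (fun p => (mu p * x p)^*) =2
    corr (fun p => mu p * x p) (fun p => (mu p * y p)^*) ->
  corr (fun p => mu p * (y p - t * x p)) (fun p => (mu p * x p)^*) =2
    corr (fun p => mu p * x p) (fun p => (mu p * (y p - t^* * x p))^*).
Proof.
move=> h p0 q0.
rewrite (eq_corr (c := fun p => mu p * y p + (- t) * (mu p * x p))
                 (e := fun p => (mu p * x p)^*)) //; last by move=> p; ring.
rewrite [RHS](eq_corr (c := fun p => mu p * x p)
   (e := fun p => (mu p * y p)^* + (- t) * (mu p * x p)^*)) //; last first.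
  by move=> p; rewrite !rmorphM /= rmorphB /= rmorphM /= conjCK; ring.
by rewrite corrDl corrDr corrZl corrZr h.
Qed.

Lemma corr_unique (mu : bool -> box M -> C) x y (s q r : box M) :
  (forall i p, `|mu i p| = 1) ->
  (forall i, corr (fun p => mu i p * y p) (fun p => (mu i p * x p)^*) =2
    corr (fun p => mu i p * x p) (fun p => (mu i p * y p)^*)) ->
  x s != 0 -> x q != 0 -> x r != 0 -> top_of x s -> bot_of x q ->
  r != s -> r != q ->
  (forall p1 p2, ~ (p1 = s /\ p2 = q) -> ~ (p1 = q /\ p2 = s) ->
    mu true p1 * mu true p2 * (mu true s * mu true q)^* !=
    mu false p1 * mu false p2 * (mu false s * mu false q)^*) ->
  exists2 t : C, t^* = t & forall p, y p = t * x p.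
Proof.
move=> mu1 h xs xq xr ts bq rs rq gen.
have mun i p : mu i p != 0 by rewrite -normr_eq0 mu1 oner_neq0.
have muc i p : mu i p * (mu i p)^* = 1 by rewrite -normCK mu1 expr1n.
have [t ts0] : exists t, y s - t * x s = 0.
  by exists (y s / x s); rewrite divfK // subrr.
pose a p := y p - t * x p; pose g p := y p - t^* * x p.
have hs i : corr (fun p => mu i p * a p) (fun p => (mu i p * x p)^*) =2
    corr (fun p => mu i p * x p) (fun p => (mu i p * g p)^*).
  exact: corr_shift (h i).
have topM i (f : box M -> C) p : top_of f p -> top_of (fun p => mu i p * f p) p.
  by move=> tf p'; rewrite mulf_eq0 negb_or => /andP[_ /tf].
have botM i (f : box M -> C) p : bot_of f p -> bot_of (fun p => (mu i p * f p)^*) p.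
  by move=> tf p'; rewrite conjC_eq0 mulf_eq0 negb_or => /andP[_ /tf].
have as0 : a s = 0 by exact: ts0.
have nz i (f : box M -> C) p : f p != 0 -> mu i p * f p != 0.
  by move=> fp; rewrite mulf_neq0.
(* Dividing the top-coefficient identities of the two masks eliminates the
   unknowns [a pa] and [g pg], so genericity determines [pa] and [pg]. *)
have lead pa pg : a pa != 0 -> g pg != 0 -> top_of a pa -> bot_of g pg ->
    (pa = q /\ pg = s).
  move=> apa gpg ta bg.
  have E i : mu i pa * mu i pg * (mu i s * mu i q)^* * (a pa * (x q)^*) =
             x s * (g pg)^*.
    have := corr_lead_eq (hs i) (topM i _ _ ta) (botM i _ _ bq)
       (topM i _ _ ts) (botM i _ _ bg) (nz i _ _ apa).
    rewrite !conjC_eq0 => /(_ (nz i _ _ xq) (nz i _ _ xs) (nz i _ _ gpg)).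
    rewrite !rmorphM /= => e.
    transitivity ((mu i pa * a pa * ((mu i q)^* * (x q)^*)) *
       (mu i pg * (mu i s)^*)); first by ring.
    rewrite e.
    transitivity ((mu i s * (mu i s)^*) * (mu i pg * (mu i pg)^*) *
       (x s * (g pg)^*)); first by rewrite /g; ring.
    by rewrite !muc !mul1r.
  have K : a pa * (x q)^* != 0 by rewrite mulf_neq0 ?conjC_eq0.
  have e := mulIf K (etrans (E true) (esym (E false))).
  have [//|n1] := pselect (pa = q /\ pg = s).
  have n2 : ~ (pa = s /\ pg = q) by case=> ps _; rewrite ps as0 eqxx in apa.
  by have := gen _ _ n2 n1; rewrite e eqxx.
(* At [s] this reads [y s = t * x s = t^* * x s] with [x s] nonzero, so [t] is real. *)
have concl : (forall p, a p = 0) -> (forall p, g p = 0) ->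
    exists2 t : C, t^* = t & forall p, y p = t * x p.
  move=> a0 g0; exists t; last by move=> p; apply/eqP; rewrite -subr_eq0; apply/eqP/a0.
  apply/(mulIf xs); move: as0 (g0 s); rewrite /a /g => /eqP + /eqP.
  by rewrite !subr_eq0 => /eqP <- /eqP <-.
(* If [a] vanishes identically, the correlation of [x] with [g] is zero, and its extreme coefficient
   forces [g] to vanish too. The case of [g] is symmetric. *)
have [/forallP a0|/forallPn[p1 /= ap1]] := boolP [forall p, a p == 0].
  apply: concl => p; first exact/eqP.
  apply/eqP; apply: contraT => /exists_bot[pg gpg bg].
  have z : forall p q,
      corr (fun p => mu true p * x p) (fun p => (mu true p * g p)^*) p q = 0.
    move=> p' q'; rewrite -(hs true) /corr big1 // => i _; rewrite big1 // => j _.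
    by have /eqP := a0 i; rewrite /a => ->; rewrite mulr0 mul0r.
  have /eqP := corr0_lead z (topM _ _ _ ts) (botM _ _ _ bg).
  by rewrite mulf_eq0 (negPf (nz _ _ _ xs)) conjC_eq0 (negPf (nz _ _ _ gpg)).
have [/forallP g0|/forallPn[p2 /= gp2]] := boolP [forall p, g p == 0].
  apply: concl => p; last exact/eqP.
  apply/eqP; apply: contraT => /exists_top[pa apa ta].
  have z : forall p q,
      corr (fun p => mu true p * a p) (fun p => (mu true p * x p)^*) p q = 0.
    move=> p' q'; rewrite (hs true) /corr big1 // => i _; rewrite big1 // => j _.
    by have /eqP := g0 j; rewrite /g => ->; rewrite mulr0 rmorph0 mulr0.
  have /eqP := corr0_lead z (topM _ _ _ ta) (botM _ _ _ bq).
  by rewrite mulf_eq0 (negPf (nz _ _ _ apa)) conjC_eq0 (negPf (nz _ _ _ xq)).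
have [pa apa ta] := exists_top ap1; have [pg gpg bg] := exists_bot gp2.
have [eq1 eq2] := lead _ _ apa gpg ta bg; subst pa pg.
(* [a] lives in weights at most that of [q] and [g] in weights at least that of [s]. *)
have ltqr : (weight q < weight r)%N.
  by rewrite ltn_neqAle bq // andbT; apply: contraNneq rq => /weight_inj ->.
have ltrs : (weight r < weight s)%N.
  by rewrite ltn_neqAle ts // andbT; apply: contraNneq rs => /weight_inj ->.
have ar : a r = 0.
  by apply/eqP; apply: contraT => /ta; rewrite leqNgt ltqr.
have gr : g r = 0.
  by apply/eqP; apply: contraT => /bg; rewrite leqNgt ltrs.
have tt : t^* = t.
  apply/(mulIf xr); move: ar gr; rewrite /a /g => /eqP + /eqP.
  by rewrite !subr_eq0 => /eqP <- /eqP <-.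
(* Now [q] lies in the support of [g], although it is lighter than the bottom [s] of [g]. *)
have ga : g =1 a by move=> p; rewrite /g tt.
by move: apa; rewrite -ga => /bg; rewrite leqNgt (ltn_trans ltqr).
Qed.

End Correlation.

(** * Complex exponentials of real phases *)

Section Expi.
Variable R : realType.
Local Notation expi := (@expi R).

Lemma expi0 : expi 0 = 1.
Proof. by rewrite /Defs.expi cos0 sin0. Qed.

Lemma expiD (x y : R) : expi (x + y) = expi x * expi y.
Proof.
apply/eqP; rewrite eq_complex /= cosD sinD !eqxx /=.
by apply/eqP; ring.
Qed.

Lemma expi_conj (x : R) : (expi x)^* = expi (- x).
Proof. by rewrite /Defs.expi cosN sinN. Qed.

Lemma expi_sum (I : finType) (F : I -> R) :
  expi (\sum_i F i) = \prod_i expi (F i).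
Proof. exact: (big_morph expi expiD expi0). Qed.

Lemma expi_mulrn (x : R) n : expi (x *+ n) = expi x ^+ n.
Proof.
elim: n => [|n IH]; first by rewrite mulr0n expi0 expr0.
by rewrite mulrS exprS expiD IH.
Qed.

Lemma expi_int (z : int) : expi (- (2 * pi * z%:~R)) = 1.
Proof.
have e1 : expi (2 * pi) = 1.
  by rewrite /Defs.expi mulr_natl cos2pi sin2pi.
case: z => n.
  rewrite -expi_conj -pmulrn mulr_natr expi_mulrn e1 expr1n.
  exact: rmorph1.
by rewrite NegzE mulrNz mulrN opprK -pmulrn mulr_natr expi_mulrn e1 expr1n.
Qed.

(** By the double-angle formula a full turn would give [sin (pi * x) = 0], against the positivity of
    sine strictly between 0 and [pi]. *)
Lemma expi_neq1 (x : R) : x != 0 -> `|x| < 1 -> expi (- (2 * pi * x)) != 1.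
Proof.
move=> x0 x1; apply/negP => /eqP[c1 _].
have {c1} : sin (pi * x) = 0.
  apply/eqP; rewrite -sqrf_eq0.
  move: c1; rewrite cosN (_ : 2 * pi * x = (pi * x) *+ 2); last by ring.
  rewrite cos_mulr2n => h.
  by have := cos2Dsin2 (pi * x) => h2; apply/eqP; lra.
have pp := pi_gt0 R.
case: (ltrgtP x 0) x0 => // sx _.
- rewrite -[x]opprK mulrN sinN => /eqP; rewrite oppr_eq0 => /eqP s0.
  have := @sin_gt0_pi _ (pi * - x); rewrite s0 ltxx ltr0_norm // in x1 * => H.
  by have := H; rewrite pmulr_rgt0 // oppr_gt0 sx /= gtr_pMr // x1 => /(_ isT).
- move=> s0; have := @sin_gt0_pi _ (pi * x); rewrite s0 ltxx gtr0_norm // in x1 *.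
  by rewrite pmulr_rgt0 // sx /= gtr_pMr // x1 => /(_ isT).
Qed.

End Expi.

(** * Inversion of the oversampled Fourier transform *)

Section DFT.
Variables (R : realType) (d : nat) (M : 'I_d -> nat).
Local Notation C := R[i].
Local Notation expi := (@expi R).

(** The character of integer lag [v] on the frequency grid, kept as a product so that shifting one
    frequency coordinate alters a single factor. *)
Definition wave (v : 'I_d -> int) (k : freq_box M) : C :=
  \prod_j expi (- (2 * pi * ((v j)%:~R * freq k j))).

Definition shift_freq (j : 'I_d) (k : freq_box M) : freq_box M :=
  [ffun i => if i == j then ordS (k i) else k i].

Lemma shift_freq_bij j : bijective (shift_freq j).
Proof.
pose g (k : freq_box M) : freq_box M :=
  [ffun i => if i == j then ord_pred (k i) else k i].
exists g => k; apply/ffunP => i; rewrite !ffunE; case: eqP => // _.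
- exact: ordSK.
- exact: ord_predK.
Qed.

Lemma wave_shift v j k : wave v (shift_freq j k) =
  expi (- (2 * pi * ((v j)%:~R / (2 * M j).+1%:R))) * wave v k.
Proof.
have wE k' : wave v k' = expi (- (2 * pi * ((v j)%:~R * freq k' j))) *
    \prod_(i | i != j) expi (- (2 * pi * ((v i)%:~R * freq k' i))).
  by rewrite /wave (bigD1 j).
rewrite !wE mulrA; congr (_ * _); last first.
  apply: eq_bigr => i ij.
  by rewrite /freq /shift_freq ffunE (negPf ij).
rewrite /freq /shift_freq ffunE eqxx -expiD.
have n0 : (2 * M j).+1%:R != 0 :> R by rewrite pnatr_eq0.
have kn := ltn_ord (k j); rewrite [nat_of_ord (ordS _)]/=.
have [lt|ge] := ltnP (k j).+1 (2 * M j).+1.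
  rewrite modn_small // -[(nat_of_ord (k j)).+1]addn1 natrD; congr expi; field.
  by rewrite -natr1 in n0.
have kE : (k j).+1 = (2 * M j).+1 by apply/eqP; rewrite eqn_leq ge kn.
(* At the wrap-around from the last frequency to the first, the phases differ by [v j] full
   turns. *)
rewrite {1}kE modnn mul0r mulr0 mulr0 oppr0 expi0 -(expi_int _ (v j)); congr expi.
have -> : (nat_of_ord (k j))%:R = (2 * M j).+1%:R - 1 :> R.
  have /(congr1 (fun n => n%:R : R)) := kE; rewrite -[LHS]natr1 => <-.
  by rewrite addrK.
by field.
Qed.

Lemma sum_wave_eq0 v j : v j != 0 -> (`|v j| <= 2 * M j)%N ->
  \sum_k wave v k = 0.
Proof.
move=> v0 vM; set S := \sum_k _.
set z := expi (- (2 * pi * ((v j)%:~R / (2 * M j).+1%:R))).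
(* Cyclically shifting the j-th frequency permutes the terms of [S] and
   multiplies each of them by [z]. *)
have e : S = z * S.
  rewrite {1}/S (reindex (shift_freq j)) /=; last exact/onW_bij/shift_freq_bij.
  rewrite big_distrr /=; apply: eq_bigr => k _; exact: wave_shift.
have z1 : z != 1.
  apply: expi_neq1; first by rewrite mulf_neq0 ?intr_eq0 // invr_eq0 pnatr_eq0.
  rewrite normrM normfV (ger0_norm (ler0n _ _)) ltr_pdivrMr ?ltr0n // mul1r.
  by rewrite -intr_norm -[X in _ < X]/((2 * M j).+1%:~R) ltr_int -abszE ltz_nat ltnS.
apply/eqP; have /eqP : (z - 1) * S = 0 by rewrite mulrBl mul1r -e subrr.
by rewrite mulf_eq0 subr_eq0 (negPf z1).
Qed.

Definition dft (a : box M -> C) (k : freq_box M) : C :=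
  \sum_p a p * wave (fun j => (p j)%:Z) k.

Lemma waveD v w k : wave (fun j => v j + w j) k = wave v k * wave w k.
Proof.
rewrite /wave -big_split; apply: eq_bigr => j _ /=.
by rewrite -expiD intrD; congr Defs.expi; ring.
Qed.

Lemma waveN v k : (wave v k)^* = wave (fun j => - v j) k.
Proof.
rewrite /wave rmorph_prod; apply: eq_bigr => j _ /=.
by rewrite expi_conj mulrNz mulNr mulrN.
Qed.

(** Orthogonality of characters keeps exactly the pairs of lag [p0 - q0]: two lags differ by at most
    [2 * M j] in each coordinate, so [2 * M j + 1] frequencies separate them without aliasing. *)
Lemma dft_inversion (a b : box M -> C) (p0 q0 : box M) :
  \sum_k (dft a k * (dft b k)^*) *
     wave (fun j => (q0 j)%:Z - (p0 j)%:Z) k =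
  #|freq_box M|%:R * corr a (fun q => (b q)^*) p0 q0.
Proof.
pose v (p q : box M) j := (p j)%:Z + (- (q j)%:Z + ((q0 j)%:Z - (p0 j)%:Z)) : int.
have vE p q j : (v p q j == 0) = (p j + q0 j == p0 j + q j)%N.
  rewrite /v; move: (nat_of_ord (p j)) (nat_of_ord (q j)).
  move: (nat_of_ord (p0 j)) (nat_of_ord (q0 j)) => e f g h.
  by apply/eqP/eqP; lia.
transitivity (\sum_p \sum_q a p * (b q)^* * \sum_k wave (v p q) k).
  rewrite (eq_bigr (fun k => \sum_p \sum_q a p * (b q)^* * wave (v p q) k)).
    rewrite exchange_big; apply: eq_bigr => p _.
    rewrite exchange_big; apply: eq_bigr => q _.
    by rewrite big_distrr.
  move=> k _; rewrite /dft rmorph_sum /= !big_distrl /=.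
  apply: eq_bigr => p _; rewrite big_distrr big_distrl /=; apply: eq_bigr => q _.
  by rewrite rmorphM /= waveN !waveD; ring.
rewrite /corr big_distrr /=; apply: eq_bigr => p _.
rewrite big_distrr /= [RHS]big_mkcond; apply: eq_bigr => q _ /=.
case: ifP => [/forallP sd|/negbT/forallPn[j nj]].
  rewrite (eq_bigr (fun=> 1)) ?sumr_const ?cardT -?cardE; first by ring.
  move=> k _; rewrite /wave big1 // => j _.
  have -> : v p q j = 0 by apply/eqP; rewrite vE sd.
  by rewrite mul0r mulr0 oppr0 expi0.
rewrite (@sum_wave_eq0 _ j) ?mulr0 // ?vE // /v.
have := ltn_ord (p j); have := ltn_ord (q j).
have := ltn_ord (p0 j); have := ltn_ord (q0 j).
move: (nat_of_ord (p j)) (nat_of_ord (q j)) (nat_of_ord (p0 j)) (nat_of_ord (q0 j)).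
by move=> ? ? ? ?; lia.
Qed.

Lemma corr_of_dft (a b c e : box M -> C) :
  (forall k, dft a k * (dft b k)^* = dft c k * (dft e k)^*) ->
  corr a (fun q => (b q)^*) =2 corr c (fun q => (e q)^*).
Proof.
move=> h p0 q0.
have N0 : #|freq_box M|%:R != 0 :> C.
  by rewrite pnatr_eq0 -lt0n; apply/card_gt0P; exists [ffun=> ord0].
apply: (mulfI N0); rewrite -!dft_inversion.
by apply: eq_bigr => k _; rewrite h.
Qed.

End DFT.

(** * Atomless laws and coincidence of independent variables *)

Section Atomless.
Context {R : realType} {dO : measure_display} {Om : measurableType dO}.
Variable P : probability Om R.

(** For [s < t] the mass at [t] is at most [cdf X t - cdf X s], which continuity makes arbitrarily
    small. *)
Lemma continuous_cdf_atomless (X : {RV P >-> R}) (t : R) :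
  continuous (cdf X) -> P (X @^-1` [set t]) = 0%E.
Proof.
move=> cX; apply/eqP; rewrite eq_le measure_ge0 andbT.
apply/lee_addgt0Pr => e e0; rewrite add0e.
have m (A : set R) : measurable A -> measurable (X @^-1` A).
  by move=> mA; rewrite -[X in measurable X]setTI; exact: measurable_funP.
have fin s : cdf X s \is a fin_num.
  by rewrite ge0_fin_numE ?cdf_ge0 // (le_lt_trans (cdf_le1 X s)) // ltry.
have cf : cdf X s @[s --> t] --> (fine (cdf X t))%:E.
  by rewrite fineK; [exact: (cX t)|exact: fin].
move/fine_cvgP : cf => [_ cf].
have : \forall s \near t^'-, `|fine (cdf X t) - fine (cdf X s)| < e.
  by move/cvg_at_left_filter/cvgrPdist_lt : cf => /(_ _ e0).
move=> near_e.
have [s [st es]] : exists s, s < t /\ `|fine (cdf X t) - fine (cdf X s)| < e.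
  near t^'- => s; exists s; split; first by near: s; exact: nbhs_left_lt.
  by near: s.
pose St := X @^-1` [set` `]-oo, t]]; pose Ss := X @^-1` [set` `]-oo, s]].
have sub : P (X @^-1` [set t]) = P ((St `\` Ss) `&` X @^-1` [set t]).
  congr (P _); apply/seteqP; split => w /=; last by case.
  by rewrite /St /Ss /= => ->; rewrite !in_itv /= lexx; split => //; split => //; rewrite leNgt st.
rewrite sub (@le_trans _ _ (P (St `\` Ss))) //.
  apply: le_measure; rewrite ?inE; last by apply: subIsetl.
  - by apply: measurableI; [apply: measurableD|]; apply: m.
  - by apply: measurableD; apply: m.
rewrite measureD; [|exact: m|exact: m|]; last first.
  by rewrite (le_lt_trans (probability_le1 P _)) ?ltry //; exact: m.
rewrite (_ : _ `&` _ = Ss); last first.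
  apply/seteqP; split => w /=; first by case.
  by rewrite /St /Ss /= !in_itv /= => h; split => //; rewrite (le_trans h) // ltW.
rewrite -[X in (X - _)%E]/(cdf X t) -[X in (_ - X)%E]/(cdf X s).
rewrite -(fineK (fin t)) -(fineK (fin s)) -EFinB lee_fin.
by apply: le_trans (ltW es); exact: ler_norm.
Unshelve. all: by end_near.
Qed.

Lemma cos_injective_period (n : nat) (x y : R) :
  pi *+ n <= x < pi *+ n.+1 -> pi *+ n <= y < pi *+ n.+1 ->
  cos x = cos y -> x = y.
Proof.
move=> /andP[nx xn] /andP[ny yn].
have red (z : R) : pi *+ n <= z -> z < pi *+ n.+1 -> z - pi *+ n \in `[0, pi].
  move=> nz zn; rewrite in_itv /= subr_ge0 nz /= lerBlDr -mulrS; exact: ltW.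
have shift (z : R) : cos (z - pi *+ n + pi *+ n) = (-1) ^+ n * cos (z - pi *+ n).
  exact: (alternatingn (@cosDpi R)).
have := shift x; have := shift y; rewrite !subrK => -> -> /mulfI.
rewrite signr_eq0 => /(_ isT) /cos_inj h.
by apply: (addIr (- (pi *+ n))); apply: h; exact: red.
Qed.

(** On each half-period of [|X| *+ e] the cosine determines [|X|], so countably many null events
    [X = t] cover the level set. *)
Lemma cos_atomless (X : {RV P >-> R}) (e : nat) (c : R) : (0 < e)%N ->
  continuous (cdf X) -> P.-negligible [set w | cos (X w *+ e) = c].
Proof.
move=> e0 cX.
have pp := pi_gt0 R.
have at_ t : P.-negligible (X @^-1` [set t]).
  apply/negligibleP; last exact: continuous_cdf_atomless.
  by rewrite -[X in measurable X]setTI; exact: measurable_funP.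
pose I n := [set t : R | pi *+ n <= `|t| *+ e < pi *+ n.+1].
pose F n := [set w | cos (X w *+ e) = c /\ I n (X w)].
apply: (@negligibleS _ _ _ _ (\bigcup_n F n)).
  move=> w /= cw; exists (Num.truncn (`|X w| *+ e / pi)) => //; split => //=.
  have /andP[h1 h2] : (Num.truncn (`|X w| *+ e / pi))%:R <= `|X w| *+ e / pi <
     (Num.truncn (`|X w| *+ e / pi)).+1%:R.
    by apply: truncn_itv; apply: divr_ge0; [exact: mulrn_wge0|exact: ltW].
  rewrite /I /= -[pi *+ _]mulr_natl -[X in _ < X]mulr_natl.
  by rewrite -ler_pdivlMr // h1 -ltr_pdivrMr.
apply: negligible_bigcup => n.
have [[w0 [c0 I0]]|no] := pselect (exists w, F n w); last first.
  by apply: (negligibleS _ (negligible_set0 P)) => w Fw; apply: no; exists w.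
apply: (@negligibleS _ _ _ _ (X @^-1` [set X w0] `|` X @^-1` [set - X w0])); last first.
  exact: negligibleU.
move=> w [cw Iw].
have cosabs t : cos (`|t| *+ e) = cos (t *+ e).
  by have [_|_] := ger0P t => //; rewrite mulNrn cosN.
have : `|X w| *+ e = `|X w0| *+ e.
  by apply: cos_injective_period Iw I0 _; rewrite !cosabs c0.
move/eqP; rewrite eqr_pMn2r // eqr_norm2 => /orP[]/eqP; first by left.
by right.
Qed.

Lemma independent_eq_negligible (U V : {RV P >-> R}) :
  (forall A B : set R, measurable A -> measurable B ->
     P (U @^-1` A `&` V @^-1` B) = (P (U @^-1` A) * P (V @^-1` B))%E) ->
  (forall t, P.-negligible [set w | U w = t]) ->
  P.-negligible [set w | U w = V w].
Proof.
move=> ind at_.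
have mUV : measurable_fun setT (fun w => (V w, U w)).
  by apply: measurable_fun_pair; exact: measurable_funP.
pose VU : {mfun Om >-> (R * R)%type} := HB.pack (fun w => (V w, U w))
  (isMeasurableFun.Build _ _ _ _ _ mUV).
(* The joint law is the product of the marginals, and it gives the diagonal
   mass 0 because every section of the diagonal is a point. *)
pose D : set (R * R) := [set z | z.1 = z.2].
have mD : measurable D.
  have -> : D = (fun z : R * R => z.1 - z.2) @^-1` [set 0].
    apply/seteqP; split => z /=; first by rewrite /D /= => ->; rewrite subrr.
    by move=> /eqP; rewrite subr_eq0 => /eqP.
  rewrite -[X in measurable X]setTI.
  by apply: (measurable_realfun.measurable_funB (@measurable_fst _ _ _ _)
    (@measurable_snd _ _ _ _)).
have E : (distribution P V \x distribution P U)%E D = distribution P VU D.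
  apply: product_measure_unique => // A B mA mB.
  rewrite /pushforward /distribution muleC -ind //; congr (P _).
  by apply/seteqP; split => w [].
have mE : measurable [set w | U w = V w].
  have -> : [set w | U w = V w] = setT `&` (fun w => (V w, U w)) @^-1` D.
    by rewrite setTI; apply/seteqP; split => w /esym.
  exact (mUV measurableT D mD).
apply/negligibleP => //.
transitivity (distribution P VU D).
  by congr (P _); apply/seteqP; split => w /esym.
rewrite -E /product_measure1; apply: integral0_eq => v _ /=.
rewrite /distribution /pushforward.
have -> : U @^-1` xsection D v = [set w | U w = v].
  apply/seteqP; split => w /=; rewrite /xsection /= inE /D /=; by move/esym.
apply: measure_negligible (at_ v); rewrite -[X in measurable X]setTI.
exact: (measurable_funP U _ _ (measurable_set1 v)).
Qed.

End Atomless.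

(** * Measurability of complex-valued functions *)

Section ComplexMeasurable.
Context {R : realType} {d : measure_display} {T : measurableType d}.
Local Notation C := R[i].

Definition cmeasurable (f : T -> C) :=
  measurable_fun setT (fun w => complex.Re (f w)) /\
  measurable_fun setT (fun w => complex.Im (f w)).

Lemma cmeasurableM f g : cmeasurable f -> cmeasurable g ->
  cmeasurable (fun w => f w * g w).
Proof.
move=> [f1 f2] [g1 g2]; split.
- rewrite (_ : (fun w => _) = (fun w => complex.Re (f w) * complex.Re (g w)
    - complex.Im (f w) * complex.Im (g w))).
    by apply: measurable_realfun.measurable_funB;
      exact: measurable_realfun.measurable_funM.
  by apply/funext => w; case: (f w) (g w) => [a b] [].
- rewrite (_ : (fun w => _) = (fun w => complex.Re (f w) * complex.Im (g w)
    + complex.Im (f w) * complex.Re (g w))).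
    by apply: measurable_realfun.measurable_funD;
      exact: measurable_realfun.measurable_funM.
  by apply/funext => w; case: (f w) (g w) => [a b] [].
Qed.

Lemma cmeasurable_conj f : cmeasurable f -> cmeasurable (fun w => (f w)^*).
Proof.
move=> [f1 f2]; split.
- by rewrite (_ : (fun w => _) = (fun w => complex.Re (f w))) //;
    apply/funext => w; case: (f w).
- rewrite (_ : (fun w => _) = (fun w => - complex.Im (f w))).
    exact: measurable_realfun.measurable_funN.
  by apply/funext => w; case: (f w).
Qed.

End ComplexMeasurable.

(** * Almost sure genericity of a random mask *)

Section GenericMasks.
Context {R : realType} {dO : measure_display} {Om : measurableType dO}.
Variable P : probability Om R.
Variables (T : finType) (l : nat) (mu : 'I_l -> Om -> T -> R[i]) (j : 'I_l).
Hypothesis hmu : forall i, random_phase_mask (mu i).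
Variable phi : T -> {RV P >-> R}.
Hypothesis cphi : forall n, continuous (cdf (phi n)).
Hypothesis iphi : mutually_independent P
  (fun n => preimage_set_system setT (phi n) measurable).
Hypothesis muphi : forall w n, mu j w n = expi (phi n w).
Hypothesis ind : independent_events P (sigma_masks mu [set j]) (sigma_masks mu [set~ j]).

(* Independence within the mask concerns the phases [phi n], which the mask does
   not determine, whereas independence from the other masks concerns sigma(mu j):
   only the events of this intersection enjoy both. *)
Definition mask_events n : set (set Om) :=
  preimage_set_system setT (phi n) measurable `&` sigma_masks mu [set j].

(* A pi-system generating everything random except [mu j p]. *)
Definition other_events p : set (set Om) :=
  [set B | exists (E : T -> set Om) (H : set Om),
    [/\ forall n, mask_events n (E n), sigma_masks mu [set~ j] H &
        B = \bigcap_(n in [set` [set~ p]%SET]) E n `&` H]].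

Lemma sigma_masks_sigma_algebra J : sigma_algebra setT (sigma_masks mu J).
Proof. exact: smallest_sigma_algebra. Qed.

Lemma sigma_masksT J : sigma_masks mu J setT.
Proof.
have [s0 sD _] := sigma_masks_sigma_algebra J.
by have := sD _ s0; rewrite setD0.
Qed.

Lemma sigma_masksI J A B : sigma_masks mu J A -> sigma_masks mu J B ->
  sigma_masks mu J (A `&` B).
Proof.
move=> sA sB; have [s0 sD sU] := sigma_masks_sigma_algebra J.
rewrite -[A `&` B]setCK setCI -setTD; apply: (sD).
rewrite -bigcup2E; apply: sU => -[|[|n]] /=; rewrite -?setTD //; exact: (sD).
Qed.

Lemma sigma_masks_measurable J A : sigma_masks mu J A -> measurable A.
Proof.
apply: smallest_sub; first exact: sigma_algebra_measurable.
move=> B [i _ [n _ [[D mD <-]|[D mD <-]]]]; have [_ /(_ n)[m1 m2]] := hmu i.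
- exact: m1.
- exact: m2.
Qed.

Lemma mask_eventsT n : mask_events n setT.
Proof.
split; last exact: sigma_masksT.
by exists setT => //; rewrite preimage_setT setIT.
Qed.

Lemma mask_eventsI n A B : mask_events n A -> mask_events n B -> mask_events n (A `&` B).
Proof.
move=> [[D mD <-] sA] [[D' mD' <-] sB]; split; last exact: sigma_masksI.
exists (D `&` D'); first exact: measurableI.
by rewrite preimage_setI !setTI.
Qed.

Lemma sigma_masks_bigcap J (K : {set T}) (E : T -> set Om) :
  (forall n, sigma_masks mu J (E n)) -> sigma_masks mu J (\bigcap_(n in [set` K]) E n).
Proof.
move=> sE; rewrite (_ : [set` K] = [set` enum K]); last first.
  by apply/seteqP; split => n /=; rewrite mem_enum.
rewrite bigcap_seq; apply: big_ind => [||n _]; first exact: sigma_masksT.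
- exact: sigma_masksI.
- exact: sE.
Qed.

Lemma other_events_setI p : setI_closed (other_events p).
Proof.
move=> _ _ [E [H [hE hH ->]]] [E' [H' [hE' hH' ->]]].
exists (fun n => E n `&` E' n), (H `&` H'); split.
- by move=> n; exact: mask_eventsI.
- exact: sigma_masksI.
- by rewrite bigcapI setIACA.
Qed.

Lemma other_events_sigma p : other_events p `<=` sigma_masks mu setT.
Proof.
have sub J : sigma_masks mu J `<=` sigma_masks mu setT.
  by apply: sub_sigma_algebra2 => A [i _ h]; exists i.
move=> _ [E [H [hE hH ->]]]; apply: sigma_masksI; last exact: sub hH.
by apply: sigma_masks_bigcap => n; have [_ /sub] := hE n.
Qed.

Lemma other_events_measurable p : other_events p `<=` measurable.
Proof. by move=> A /other_events_sigma /sigma_masks_measurable. Qed.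

(** First [ind] separates [H] from the events of mask [j], then [iphi] separates [A] from the events
    at the points other than [p]. *)
Lemma other_events_indep p A B : mask_events p A -> other_events p B ->
  P (A `&` B) = (P A * P B)%E.
Proof.
move=> mA [E [H [hE hH ->]]].
have capE n : n \in [set~ p]%SET -> n != p by rewrite !inE.
pose E' n := if n == p then A else E n.
have hE' n : mask_events n (E' n).
  by rewrite /E'; case: eqP => // ->.
have -> : \bigcap_(n in [set` [set~ p]%SET]) E n =
    \bigcap_(n in [set` [set~ p]%SET]) E' n.
  by apply: eq_bigcapr => n /capE np; rewrite /E' (negPf np).
set F := \bigcap_(n in _) _.
have AF : A `&` F = \bigcap_(n in [set` [set: T]%SET]) E' n.
  apply/seteqP; split => [w [Aw Fw] n _|w h].
    by have [->|np] := eqVneq n p; [rewrite /E' eqxx|apply: Fw => /=; rewrite !inE].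
  split; first by have := h p; rewrite /E' eqxx /= inE; exact.
  by move=> n _; apply: h; rewrite /= inE.
have sF : sigma_masks mu [set j] F.
  by apply: sigma_masks_bigcap => n; have [] := hE' n.
have sA : sigma_masks mu [set j] A by case: mA.
rewrite setIA ind //; last exact: sigma_masksI.
rewrite (ind sF hH) muleA; congr (_ * _)%E.
rewrite AF iphi; last by move=> n _; have [] := hE' n.
rewrite iphi; last by move=> n _; have [] := hE' n.
rewrite (bigD1 p) ?inE //= {1}/E' eqxx; congr (_ * _)%E.
by apply: eq_bigl => n; rewrite !inE.
Qed.

(** Both sides are finite measures in [B] that agree on the pi-system [other_events p], hence on the
    sigma-algebra it generates. *)
Lemma other_sigma_indep p A B : mask_events p A -> <<s other_events p >> B ->
  P (A `&` B) = (P A * P B)%E.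
Proof.
move=> mA sB.
have meA : measurable A by have [_ /sigma_masks_measurable] := mA.
have fA : P A \is a fin_num by exact: fin_num_measure.
pose a : {nonneg R} := NngNum (fine_ge0 (measure_ge0 P A)).
pose m1 := mrestr P meA.
have -> : P (A `&` B) = m1 B by rewrite /m1 /mrestr setIC.
have -> : (P A * P B)%E = mscale a P B by rewrite /mscale /= fineK.
have OT : other_events p setT.
  exists (fun=> setT), setT; split => //.
  - by move=> n; exact: mask_eventsT.
  - exact: sigma_masksT.
  - by rewrite setIT; apply/seteqP; split => // w _ n.
apply: (g_sigma_algebra_measure_unique (other_events p)
  (@other_events_measurable p) (fun=> setT)) => //.
- by apply/seteqP; split => // w _; exists 0%N.
- exact: other_events_setI.
- move=> D oD /=; rewrite /m1 /mrestr setIC (other_events_indep mA oD).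
  by rewrite /mscale /= fineK.
- by move=> _ /=; rewrite /m1 /mrestr setTI (le_lt_trans (probability_le1 P meA)) ?ltry.
Qed.

Local Notation Omp p := (g_sigma_algebraType (other_events p)).

Lemma other_mask_cmeasurable p i n : i != j ->
  @cmeasurable _ _ (Omp p) (fun w => mu i w n).
Proof.
move=> ij.
have inc A : sigma_masks mu [set~ j] A -> <<s other_events p >> A.
  move=> sA; apply: sub_sigma_algebra; exists (fun=> setT), A; split => //.
    by move=> ?; exact: mask_eventsT.
  by rewrite [X in X `&` _](_ : _ = setT) ?setTI //; apply/seteqP; split => // w _ ?.
split => _ D mD; apply: inc; apply: sub_sigma_algebra; exists i => /=; try exact/eqP;
  exists n => //; [left|right]; by exists D.
Qed.

(** The parts of [mu j n] are the cosine and sine of [phi n], so their events are preimages under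
    [phi n] as well as events of the mask, as [mask_events] demands. *)
Lemma same_mask_cmeasurable p n : n != p ->
  @cmeasurable _ _ (Omp p) (fun w => mu j w n).
Proof.
move=> np.
have inc A : mask_events n A -> <<s other_events p >> A.
  move=> sA; apply: sub_sigma_algebra.
  exists (fun m => if m == n then A else setT), setT; split.
  - by move=> m; case: eqP => [->//|_]; exact: mask_eventsT.
  - exact: sigma_masksT.
  rewrite setIT; apply/seteqP; split => w.
    by move=> Aw m _; case: eqP.
  by move=> /(_ n) /=; rewrite eqxx !inE; exact.
have rr : (fun w => complex.Re (mu j w n)) = cos \o phi n.
  by apply/funext => w; rewrite muphi.
have ii : (fun w => complex.Im (mu j w n)) = sin \o phi n.
  by apply/funext => w; rewrite muphi.
split => _ D mD; apply: inc; split.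
- rewrite rr; exists (cos @^-1` D) => //; rewrite -[_ @^-1` _]setTI.
  exact: (measurable_realfun.continuous_measurable_fun (@continuous_cos R)).
- by apply: sub_sigma_algebra; exists j => //; exists n => //; left; exists D.
- rewrite ii; exists (sin @^-1` D) => //; rewrite -[_ @^-1` _]setTI.
  exact: (measurable_realfun.continuous_measurable_fun (@continuous_sin R)).
- by apply: sub_sigma_algebra; exists j => //; exists n => //; right; exists D.
Qed.

(** Equality forces [cos (phi p *+ e)] to equal the real part of [Z], and the former is atomless and
    independent of the latter. *)
Lemma mask_power_negligible p e (Z : Om -> R[i]) : (e == 1)%N || (e == 2)%N ->
  @cmeasurable _ _ (Omp p) Z -> P.-negligible [set w | mu j w p ^+ e = Z w].
Proof.
move=> he [mZ _].
have subm : <<s other_events p >> `<=` @measurable _ Om.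
  apply: smallest_sub; [exact: sigma_algebra_measurable|exact: other_events_measurable].
have mV : measurable_fun setT (fun w : Om => complex.Re (Z w)).
  by move=> _ D mD; apply: subm; exact: mZ.
(* The multiple-angle polynomial makes [cos (phi p *+ e)] a function of the real part of [mu j p],
   so its events lie in the sigma-algebra of the mask and not only in that of [phi p]. *)
pose h (x : R) := if e == 1%N then x else x ^+ 2 *+ 2 - 1.
have mh : measurable_fun setT h.
  rewrite /h; case: eqP => _; first exact: measurable_id.
  apply: measurable_realfun.continuous_measurable_fun => x.
  apply: cvgB; last exact: cvg_cst.
  by rewrite /GRing.natmul /=; apply: cvgD; apply: cvgM; exact: cvg_id.
have hcos (x : R) : cos (x *+ e) = h (cos x).
  by rewrite /h; case/orP: he => /eqP -> //=; rewrite cos_mulr2n.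
have mhc : measurable_fun setT (h \o cos).
  apply: measurableT_comp mh _.
  exact: (measurable_realfun.continuous_measurable_fun (@continuous_cos R)).
have mU : measurable_fun setT (fun w => cos (phi p w *+ e)).
  rewrite (_ : (fun w => _) = h \o cos \o phi p); last by apply/funext => w /=.
  by apply: (measurableT_comp mhc); exact: measurable_funP.
pose U : {RV P >-> R} := HB.pack (fun w => cos (phi p w *+ e))
  (isMeasurableFun.Build _ _ _ _ _ mU).
pose V : {RV P >-> R} := HB.pack (fun w => complex.Re (Z w))
  (isMeasurableFun.Build _ _ _ _ _ mV).
have neg : P.-negligible [set w | U w = V w].
  apply: independent_eq_negligible => [A B mA mB|t].
    apply: (@other_sigma_indep p); last first.
      by have := mZ measurableT B mB; rewrite setTI.
    have mhA : measurable (h @^-1` A) by rewrite -[X in measurable X]setTI; exact: mh.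
    split.
      exists ((h \o cos) @^-1` A).
        rewrite -[X in measurable X]setTI.
        exact: mhc.
      by rewrite setTI; apply/seteqP; split => w /=; rewrite hcos.
    apply: sub_sigma_algebra; exists j => //; exists p => //; left.
    exists (h @^-1` A) => //; rewrite setTI.
    by apply/seteqP; split => w /=; rewrite hcos muphi.
  apply: cos_atomless; last exact: cphi.
  by case/orP: he => /eqP ->.
apply: negligibleS neg => w /= e1.
by rewrite /U /V /= -e1 muphi -expi_mulrn.
Qed.

Lemma mask_norm i w n : `|mu i w n| = 1.
Proof. by have [h _] := hmu i; exact: h. Qed.

Lemma mask_mul_conj i w n : mu i w n * (mu i w n)^* = 1.
Proof. by rewrite -normCK mask_norm expr1n. Qed.

(** Outside the two excluded matchings some phase of mask [j] survives cancellation; solving for it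
    prescribes this phase or its square by data independent of it. *)
Lemma mask_relation_negligible i s q p1 p2 : i != j -> s != q ->
  ~ (p1 = s /\ p2 = q) -> ~ (p1 = q /\ p2 = s) ->
  P.-negligible [set w |
    mu j w p1 * mu j w p2 * (mu j w s * mu j w q)^* =
    mu i w p1 * mu i w p2 * (mu i w s * mu i w q)^*].
Proof.
move=> ij sq.
(* The relation is symmetric in the two points, so after a swap either [a] avoids the pair [s, q] or
   both points belong to it. *)
suff main a b : (a \notin [:: s; q]) || (b \in [:: s; q]) ->
    ~ (a = s /\ b = q) -> ~ (a = q /\ b = s) ->
    P.-negligible [set w |
      mu j w a * mu j w b * (mu j w s * mu j w q)^* =
      mu i w a * mu i w b * (mu i w s * mu i w q)^*].
  move=> n1 n2.
  have [h1|h1] := boolP ((p1 \notin [:: s; q]) || (p2 \in [:: s; q])).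
    exact: main.
  have h2 : (p2 \notin [:: s; q]) || (p1 \in [:: s; q]).
    by move: h1; rewrite negb_or negbK => /andP[-> ->].
  apply: (negligibleS _ (main p2 p1 h2 _ _)) => [w /=|[? ?]|[? ?]].
  - by rewrite [mu j w p2 * _]mulrC [mu i w p2 * _]mulrC.
  - exact: n2.
  - exact: n1.
move: a b => {}p1 {}p2 out n1 n2.
pose Z w := mu i w p1 * mu i w p2 * (mu i w s * mu i w q)^*.
have mZ p : @cmeasurable _ _ (Omp p) Z.
  by rewrite /Z; repeat (apply: cmeasurableM || apply: cmeasurable_conj);
    exact: other_mask_cmeasurable.
have [in1|] := boolP (p1 \in [:: s; q]); last first.
  rewrite !inE negb_or => /andP[p1s p1q].
  (* If the two points coincide, the unknown phase appears squared; otherwise [mu j p2] belongs to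
     the independent data. *)
  have [e12|p21] := eqVneq p2 p1.
    apply: (negligibleS _ (@mask_power_negligible p1 2
        (fun w => Z w * (mu j w s * mu j w q)) isT _)); last first.
      apply: cmeasurableM => //; apply: cmeasurableM;
        by apply: same_mask_cmeasurable; rewrite eq_sym.
    move=> w /= e; rewrite /Z -e e12.
    rewrite -mulrA -[LHS]mulr1 -expr2; congr (_ * _).
    by rewrite -[RHS]mulrC -normCK normrM !mask_norm mulr1 expr1n.
  apply: (negligibleS _ (@mask_power_negligible p1 1
      (fun w => Z w * (mu j w s * mu j w q) * (mu j w p2)^*) isT _)); last first.
    apply: cmeasurableM; last by apply/cmeasurable_conj/same_mask_cmeasurable.
    by apply: cmeasurableM => //; apply: cmeasurableM;
      apply: same_mask_cmeasurable; rewrite eq_sym.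
  move=> w /= e; rewrite /Z -e expr1.
  rewrite (_ : _ * _ = mu j w p1 * (mu j w p2 * (mu j w p2)^*) *
     ((mu j w s * (mu j w s)^*) * (mu j w q * (mu j w q)^*))); last first.
    by rewrite rmorphM /=; ring.
  by rewrite !mask_mul_conj !mulr1.
move: out; rewrite in1 /= => in2.
(* Two points of the pair that match it in neither order coincide; one factor [mu j a] cancels, and
   the other is prescribed by [mu j b] and mask [i]. *)
have [a [b [ab pa pb]]] : exists a b, [/\ b != a, p1 = a /\ p2 = a &
    (a = s /\ b = q) \/ (a = q /\ b = s)].
  move: in1 in2; rewrite !inE => /orP[]/eqP e1 /orP[]/eqP e2.
  - by exists s, q; rewrite eq_sym; split => //; left.
  - by case: n1.
  - by case: n2.
  - by exists q, s; split => //; right.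
apply: (negligibleS _ (@mask_power_negligible a 1
    (fun w => Z w * mu j w b) isT _)); last first.
  by apply: cmeasurableM => //; exact: same_mask_cmeasurable.
move=> w /= e; rewrite /Z -e expr1; case: pa => -> ->.
have -> : mu j w s * mu j w q = mu j w a * mu j w b.
  by case: pb => -[-> ->] //; rewrite mulrC.
rewrite (_ : _ * _ = mu j w a * (mu j w a * (mu j w a)^*) *
     (mu j w b * (mu j w b)^*)); last first.
  by rewrite rmorphM /=; ring.
by rewrite !mask_mul_conj !mulr1.
Qed.

End GenericMasks.

(** * Rank of an object and points of its support *)

Section Rank.
Variables (R : realType) (d : nat).

(** The hull stays in the line through [a] and [b], so all difference vectors are multiples of
    [b - a]. *)
Lemma affine_dim_hull_pair (S : set 'rV[R]_d) (a b : 'rV[R]_d) :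
  S `<=` [set a; b] -> (affine_dim (convex_hull S) <= 1)%N.
Proof.
move=> Sab; pose L : set 'rV[R]_d := [set z | exists t : R, z = a + t *: (b - a)].
have hullL : convex_hull S `<=` L.
  apply: smallest_sub => [x y t|z /Sab[]->].
  - rewrite !inE => -[t1 ->] [t2 ->].
    exists (t%:num * t1 + (1 - t%:num) * t2).
    change (t%:num *: (a + t1 *: (b - a)) + (1 - t%:num) *: (a + t2 *: (b - a)) =
      a + (t%:num * t1 + (1 - t%:num) * t2) *: (b - a)).
    apply/rowP => i; rewrite !mxE; ring.
  - by exists 0; rewrite scale0r addr0.
  - by exists 1; rewrite scale1r addrC subrK.
apply/bigmax_leqP => k /asboolP [p [X [pS XS fX]]].
have [t0 pE] := hullL _ pS.
have XE i : exists t, row i X = t *: (b - a).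
  have [t e] := hullL _ (XS i); exists (t - t0).
  by move: e; rewrite pE -addrA => /addrI e; rewrite scalerBl -e addrAC subrr add0r.
have [t tE] := choice XE.
have -> : nat_of_ord k = \rank X by apply/esym/eqP.
have -> : X = (\col_i t i) *m (b - a).
  apply/row_matrixP => i; rewrite tE row_mul; apply/rowP => j.
  by rewrite !mxE big_ord1 !mxE.
by rewrite (leq_trans (mxrankM_maxr _ _)) // rank_leq_row.
Qed.

(** A support inside two points would have rank at most 1; this is the form in which the rank
    condition enters. *)
Lemma object_rank_third_point (M : 'I_d -> nat) (x : 'cV[R[i]]_#|box M|)
    (s q : 'rV[R]_d) : (2 <= object_rank x)%N ->
  exists r, [/\ x r 0 != 0, box_point (enum_val r) <> s
    & box_point (enum_val r) <> q].
Proof.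
move=> rk; apply: contrapT => no.
suff : (object_rank x <= 1)%N by rewrite leqNgt rk.
apply: (@affine_dim_hull_pair _ s q) => _ [r xr <-].
apply: contrapT => /not_orP[rs rq]; apply: no; exists r; split => //.
Qed.

End Rank.

(** * Euclidean norms and the real inner product *)

Section L2.
Variable R : realType.
Local Notation C := R[i].
Local Notation Re := (@complex.Re R).
Local Notation Im := (@complex.Im R).

Definition sqnorm m (u : 'cV[C]_m) : R := \sum_k (Re (u k 0) ^+ 2 + Im (u k 0) ^+ 2).

Lemma sqnorm_ge0 m (u : 'cV[C]_m) : 0 <= sqnorm u.
Proof. by apply: sumr_ge0 => k _; rewrite addr_ge0 ?sqr_ge0. Qed.

Lemma normc_sqr (z : C) : Normc.normc z ^+ 2 = Re z ^+ 2 + Im z ^+ 2.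
Proof. by case: z => a b /=; rewrite sqr_sqrtr // addr_ge0 ?sqr_ge0. Qed.

Lemma l2normE m (u : 'cV[C]_m) : l2norm u = Num.sqrt (sqnorm u).
Proof. by congr Num.sqrt; apply: eq_bigr => k _; rewrite normc_sqr. Qed.

Lemma l2norm_ge0 m (u : 'cV[C]_m) : 0 <= l2norm u.
Proof. exact: sqrtr_ge0. Qed.

Lemma sqnorm_eq0 m (u : 'cV[C]_m) : (sqnorm u == 0) = (u == 0).
Proof.
apply/eqP/eqP => [/eqP|->]; last first.
  by rewrite /sqnorm big1 // => k _; rewrite !mxE /= expr0n addr0.
rewrite psumr_eq0; last by move=> k _; rewrite addr_ge0 ?sqr_ge0.
move=> /allP h; apply/colP => k; rewrite mxE.
have /implyP := h k (mem_index_enum k); rewrite paddr_eq0 ?sqr_ge0 // => /(_ isT).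
by rewrite !sqrf_eq0 => /andP[/eqP a /eqP b]; apply/eqP; rewrite eq_complex a b !eqxx.
Qed.

Lemma l2norm_eq0 m (u : 'cV[C]_m) : (l2norm u == 0) = (u == 0).
Proof.
by rewrite l2normE sqrtr_eq0 -sqnorm_eq0 eq_le sqnorm_ge0 andbT.
Qed.

Lemma sqr_l2norm m (u : 'cV[C]_m) : l2norm u ^+ 2 = sqnorm u.
Proof. by rewrite l2normE sqr_sqrtr // sqnorm_ge0. Qed.

Lemma sqnormZ m (t : R) (u : 'cV[C]_m) : sqnorm (t%:C%C *: u) = t ^+ 2 * sqnorm u.
Proof.
rewrite /sqnorm big_distrr; apply: eq_bigr => k _ /=.
by rewrite mxE; case: (u k 0) => a b /=; ring.
Qed.

Lemma sqnormZi m (t : R) (u : 'cV[C]_m) :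
  sqnorm (('i%C * t%:C%C) *: u) = t ^+ 2 * sqnorm u.
Proof.
rewrite /sqnorm big_distrr; apply: eq_bigr => k _ /=.
by rewrite mxE; case: (u k 0) => a b /=; ring.
Qed.

Lemma sqnorm_Imvec m (u : 'cV[C]_m) : sqnorm (Imvec u) = \sum_k Im (u k 0) ^+ 2.
Proof. by apply: eq_bigr => k _; rewrite mxE /= expr0n addr0. Qed.

Lemma sqnorm_split m (u : 'cV[C]_m) :
  sqnorm u = \sum_k Re (u k 0) ^+ 2 + sqnorm (Imvec u).
Proof. by rewrite sqnorm_Imvec -big_split. Qed.

Lemma sqnorm_dot m (u : 'cV[C]_m) : (u^t* *m u) 0 0 = (sqnorm u)%:C%C.
Proof.
rewrite mxE /sqnorm rmorph_sum; apply: eq_bigr => k _.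
by rewrite !mxE; case: (u k 0) => a b; apply/eqP;
  rewrite eq_complex /=; apply/andP; split; apply/eqP; ring.
Qed.

Lemma isometry_sqnorm m n (A : 'M[C]_(m, n)) (u : 'cV[C]_n) :
  A^t* *m A = 1%:M -> sqnorm (A *m u) = sqnorm u.
Proof.
move=> iA; apply: (@complexI R); rewrite -!sqnorm_dot.
by rewrite trmx_mul map_mxM -mulmxA (mulmxA _ A) iA mul1mx.
Qed.

Lemma rdotE m (u v : 'cV[C]_m) :
  rdot u v = \sum_k (Re (u k 0) * Re (v k 0) + Im (u k 0) * Im (v k 0)).
Proof.
rewrite /rdot mxE (raddf_sum (@complex.Re R : Rcomplex R -> R)) /=.
apply: eq_bigr => k _.
by rewrite !mxE; case: (u k 0) (v k 0) => a b [e f] /=; ring.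
Qed.

Lemma conjC_real (t : C) : t^* = t -> t = (Re t)%:C%C.
Proof.
case: t => a b [e]; apply/eqP; rewrite eq_complex /= eqxx /=.
by apply/eqP; move: e; lra.
Qed.

End L2.

(** * Existence of the maximum by compactness *)

Section Compactness.
Variable R : realType.
Local Notation C := R[i].
Local Notation Re := (@complex.Re R).
Local Notation Im := (@complex.Im R).

Definition col_of_real n (v : 'rV[R]_(n + n)) : 'cV[C]_n :=
  \col_k (v 0 (lshift n k) +i* v 0 (rshift n k))%C.

Definition real_of_col n (u : 'cV[C]_n) : 'rV[R]_(n + n) :=
  row_mx (\row_k Re (u k 0)) (\row_k Im (u k 0)).

Lemma real_of_colK n : cancel (@real_of_col n) (@col_of_real n).
Proof.
move=> u; apply/colP => k; rewrite mxE /real_of_col row_mxEl row_mxEr !mxE.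
by case: (u k 0).
Qed.

Lemma sum_continuous (I : finType) (T : topologicalType) (f : I -> T -> R) :
  (forall i, continuous (f i)) -> continuous (fun x => \sum_i f i x).
Proof.
move=> cf x; apply: cvg_big => [|i _]; first exact: add_continuous.
exact: cf.
Qed.

Lemma addf_continuous (T : topologicalType) (f g : T -> R) :
  continuous f -> continuous g -> continuous (fun x => f x + g x).
Proof. by move=> cf cg x; apply: cvgD; [exact: cf|exact: cg]. Qed.

Lemma mulf_continuous (T : topologicalType) (f g : T -> R) :
  continuous f -> continuous g -> continuous (fun x => f x * g x).
Proof. by move=> cf cg x; apply: cvgM; [exact: cf|exact: cg]. Qed.

Lemma Re_col_continuous n (k : 'I_n) :
  continuous (fun v : 'rV[R]_(n + n) => Re (col_of_real v k 0)).
Proof.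
rewrite (_ : (fun v => _) = (fun v : 'rV[R]_(n + n) => v 0 (lshift n k))).
  exact: coord_continuous.
by apply/funext => v; rewrite mxE.
Qed.

Lemma Im_col_continuous n (k : 'I_n) :
  continuous (fun v : 'rV[R]_(n + n) => Im (col_of_real v k 0)).
Proof.
rewrite (_ : (fun v => _) = (fun v : 'rV[R]_(n + n) => v 0 (rshift n k))).
  exact: coord_continuous.
by apply/funext => v; rewrite mxE.
Qed.

Lemma l2normZ m (t : R) (u : 'cV[C]_m) : 0 <= t ->
  l2norm (t%:C%C *: u) = t * l2norm u.
Proof.
by move=> t0; rewrite !l2normE sqnormZ sqrtrM ?sqr_ge0 // sqrtr_sqr ger0_norm.
Qed.

Lemma ImvecZ m (t : R) (u : 'cV[C]_m) : Imvec (t%:C%C *: u) = t%:C%C *: Imvec u.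
Proof.
apply/colP => k; rewrite !mxE; case: (u k 0) => a b.
by apply/eqP; rewrite eq_complex /=; apply/andP; split; apply/eqP; ring.
Qed.

Lemma rdotZl m (t : R) (u v : 'cV[C]_m) : rdot (t%:C%C *: u) v = t * rdot u v.
Proof.
rewrite !rdotE big_distrr; apply: eq_bigr => k _ /=.
by rewrite mxE; case: (u k 0) => a b /=; ring.
Qed.

(** The quotient is invariant under positive scaling, so its square is maximised over the unit
    sphere cut by the hyperplane, a compact set containing the normalised [u0]. *)
Lemma max_Imvec_quotient m n (B : 'M[C]_(m, n)) (z u0 : 'cV[C]_n) :
  u0 != 0 -> rdot u0 z = 0 ->
  exists2 u, u != 0 /\ rdot u z = 0 & forall u', u' != 0 -> rdot u' z = 0 ->
    (l2norm u')^-1 * l2norm (Imvec (B *m u')) <=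
    (l2norm u)^-1 * l2norm (Imvec (B *m u)).
Proof.
move=> u00 u0z.
pose f (v : 'rV[R]_(n + n)) := sqnorm (Imvec (B *m col_of_real v)).
pose g (v : 'rV[R]_(n + n)) := sqnorm (col_of_real v).
pose h (v : 'rV[R]_(n + n)) := rdot (col_of_real v) z.
pose K := g @^-1` [set x | x = 1] `&` h @^-1` [set x | x = 0].
have cst (t : R) : continuous (fun _ : 'rV[R]_(n + n) => t) by exact: cst_continuous.
have cf : continuous f.
  pose L k v := \sum_i (Re (B k i) * Im (col_of_real v i 0) +
     Im (B k i) * Re (col_of_real v i 0)).
  rewrite (_ : f = fun v => \sum_k L k v * L k v).
    apply: sum_continuous => k; apply: mulf_continuous; apply: sum_continuous => i;
    by apply: addf_continuous; apply: mulf_continuous;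
      (exact: cst || exact: Im_col_continuous || exact: Re_col_continuous).
  apply/funext => v; rewrite /f sqnorm_Imvec; apply: eq_bigr => k _.
  rewrite -expr2; congr (_ ^+ 2); rewrite mxE.
  rewrite (raddf_sum (@complex.Im R : Rcomplex R -> R)) /=.
  by apply: eq_bigr => i _; case: (B k i) (col_of_real v i 0) => a b [c e].
have cg : continuous g.
  apply: sum_continuous => k; apply: addf_continuous;
  by apply: mulf_continuous; (exact: Re_col_continuous || exact: Im_col_continuous).
have ch : continuous h.
  rewrite (_ : h = fun v => \sum_k (Re (col_of_real v k 0) * Re (z k 0) +
      Im (col_of_real v k 0) * Im (z k 0))); last by apply/funext => v; exact: rdotE.
  apply: sum_continuous => k; apply: addf_continuous;
  by apply: mulf_continuous;
    (exact: cst || exact: Re_col_continuous || exact: Im_col_continuous).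
have cK : compact K.
  pose box := [set v : 'rV[R]_(n + n) | forall i, [set` `[-1, 1 : R]] (v ord0 i)].
  apply: (@subclosed_compact _ K box).
  - rewrite /K; apply: closedI.
      by apply: (@preimage_closed _ R g) => [v _|]; [exact: cg|exact: closed_eq].
    by apply: (@preimage_closed _ R h) => [v _|]; [exact: ch|exact: closed_eq].
  - by apply: (@rV_compact R _ (fun=> [set` `[-1, 1 : R]])) => i; exact: segment_compact.
  - move=> v [gv _] i /=.
    have : v 0 i ^+ 2 <= 1.
      have gv1 : g v = 1 by [].
      rewrite -gv1 /g /sqnorm; case: (split_ordP i) => k ->.
      + rewrite (bigD1 k) //= mxE /= -addrA lerDl addr_ge0 ?sqr_ge0 //.
        by apply: sumr_ge0 => ? _; rewrite addr_ge0 ?sqr_ge0.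
      + rewrite (bigD1 k) //= mxE /= addrAC lerDr addr_ge0 ?sqr_ge0 //.
        by apply: sumr_ge0 => ? _; rewrite addr_ge0 ?sqr_ge0.
    by rewrite -(expr1n _ 2) -ler_sqrt ?expr1n // sqrtr_sqr sqrtr1 ler_norml in_itv.
have toK u : u != 0 -> rdot u z = 0 -> K (real_of_col ((l2norm u)^-1%:C%C *: u)).
  move=> nz uz; rewrite /K /g /h; split; rewrite /= real_of_colK.
    by rewrite sqnormZ -sqr_l2norm -exprMn mulVf ?expr1n // l2norm_eq0.
  by rewrite rdotZl uz mulr0.
have K0 : K !=set0 by exists (real_of_col ((l2norm u0)^-1%:C%C *: u0)); exact: toK.
have [v /set_mem [gv hv] vmax] := compact_EVT_max K0 cK (continuous_subspaceT cf).
have n1 : l2norm (col_of_real v) = 1 by rewrite l2normE [sqnorm _]gv sqrtr1.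
exists (col_of_real v).
  by split => //; rewrite -l2norm_eq0 n1 oner_neq0.
move=> u' nz uz; have := vmax _ (mem_set (toK _ nz uz)).
rewrite /f real_of_colK n1 invr1 mul1r => le.
rewrite -l2normZ ?invr_ge0 ?l2norm_ge0 // -ImvecZ scalemxAr [leLHS]l2normE [leRHS]l2normE.
exact: ler_wsqrtr.
Qed.

End Compactness.

(** * Norm identities for [B] and their consequences *)

Section Deterministic.
Variables (R : realType) (d : nat) (M : 'I_d -> nat) (l : nat) (c : R[i]).
Variables (mu : 'I_l -> box M -> R[i]) (x0 : 'cV[R[i]]_#|box M|).
Local Notation C := R[i].
Local Notation Re := (@complex.Re R).
Local Notation A := (Amat c mu).
Local Notation B := (Bmat c mu x0).
Hypothesis hA : A *m A^t* = 1%:M.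

Lemma conjmx_tr m n (D : 'M[C]_(m, n)) i k : (D^t*) i k = (D k i)^*.
Proof. by rewrite !mxE. Qed.

Lemma conjmxK m n (D : 'M[C]_(m, n)) : (D^t*)^t* = D.
Proof. by apply/matrixP => i k; rewrite !conjmx_tr conjCK. Qed.

Lemma Bmat_apply (u : 'cV[C]_#|box M|) k : (B^t* *m u) k 0 =
  (phase ((Astar c mu *m x0) k 0))^* * (Astar c mu *m u) k 0.
Proof.
rewrite [LHS]mxE [X in _ = _ * X]mxE big_distrr; apply: eq_bigr => i _ /=.
rewrite conjmx_tr /Bmat mul_mx_diag mxE /Amat conjmx_tr rmorphM /= conjCK.
have -> : (omega0 c mu x0)^T 0 k = phase ((Astar c mu *m x0) k 0).
  by rewrite !mxE.
by ring.
Qed.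

Lemma phase_norm (z : C) : `|phase z| = 1.
Proof.
rewrite /phase; case: eqP => [_|/eqP z0]; first by rewrite normr1.
by rewrite normf_div normr_id divff // normr_eq0.
Qed.

Lemma phase_mul (z : C) : z = phase z * `|z|.
Proof.
rewrite /phase; case: eqP => [->|/eqP z0]; first by rewrite normr0 mulr0.
by rewrite divfK // normr_eq0.
Qed.

(** Factors of modulus one preserve the norm, so the isometry of [Astar] passes to [B^t*]; the
    convention [phase 0 = 1] keeps this true at vanishing components. *)
Lemma Bmat_sqnorm (u : 'cV[C]_#|box M|) : sqnorm (B^t* *m u) = sqnorm u.
Proof.
have iA : (Astar c mu)^t* *m Astar c mu = 1%:M.
  by move: hA; rewrite /Amat conjmxK.
rewrite -(isometry_sqnorm u iA); apply: eq_bigr => k _; rewrite Bmat_apply.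
by apply: (@complexI R); rewrite !add_Re2_Im2 normrM norm_conjC phase_norm mul1r.
Qed.

(** The image of [x0] under [B^t*] consists of the moduli of [Astar *m x0], which are real. *)
Lemma Re_Bmat_x0 (t : R) k : Re ((B^t* *m (('i%C * t%:C%C) *: x0)) k 0) = 0.
Proof.
rewrite Bmat_apply -scalemxAr; set z := (Astar c mu *m x0) k 0.
rewrite [X in _ * X](_ : _ = 'i%C * t%:C%C * (phase z * `|z|)); last first.
  by rewrite mxE -phase_mul.
transitivity (Re (`|phase z| ^+ 2 * ('i%C * t%:C%C * `|z|))).
  by rewrite normCK; congr Re; ring.
rewrite phase_norm expr1n mul1r normc_def /=; ring.
Qed.

(** Multiplying by [|z|] replaces the phase of [z] by [z] itself and leaves products that Fourier
    inversion can handle. *)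
Lemma Re_phase (z w : C) : Re ((phase z)^* * w) = 0 -> w * z^* + z * w^* = 0.
Proof.
move=> h; rewrite {1 2}[z]phase_mul rmorphM /= (conj_normC z).
have -> : w * ((phase z)^* * `|z|) + phase z * `|z| * w^* =
   `|z| * ((phase z)^* * w + ((phase z)^* * w)^*).
  by rewrite rmorphM /= conjCK; ring.
by rewrite addcJ h mulr0 mulr0.
Qed.

Hypothesis x0n : x0 != 0.
Hypothesis uniq : forall u, (forall k, Re ((B^t* *m u) k 0) = 0) ->
  exists t : R, u = ('i%C * t%:C%C) *: x0.

(** Since [B^t*] preserves the norm, equality leaves nothing for the real parts, and [uniq]
    applies. *)
Lemma l2norm_Imvec_eq u : l2norm (Imvec (B^t* *m u)) = l2norm u ->
  exists t : R, u = ('i%C * t%:C%C) *: x0.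
Proof.
move=> e; apply: uniq => k.
have : sqnorm u = sqnorm (Imvec (B^t* *m u)) by rewrite -!sqr_l2norm e.
rewrite -[LHS]Bmat_sqnorm sqnorm_split -[RHS]add0r => /addIr /eqP.
rewrite psumr_eq0; last by move=> i _; rewrite sqr_ge0.
move=> /allP h; apply/eqP; rewrite -sqrf_eq0.
by have /implyP := h k (mem_index_enum k); exact.
Qed.

Lemma l2norm_Imvec_x0 (t : R) (u := ('i%C * t%:C%C) *: x0) :
  l2norm (Imvec (B^t* *m u)) = l2norm u.
Proof.
rewrite !l2normE; congr Num.sqrt; rewrite -[RHS]Bmat_sqnorm [RHS]sqnorm_split.
by rewrite [X in X + _]big1 ?add0r // => k _; rewrite Re_Bmat_x0 expr0n.
Qed.

Lemma l2norm_Imvec_le u : l2norm (Imvec (B^t* *m u)) <= l2norm u.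
Proof.
rewrite !l2normE; apply: ler_wsqrtr; rewrite -[leRHS]Bmat_sqnorm [leRHS]sqnorm_split.
by rewrite lerDr; apply: sumr_ge0 => i _; rewrite sqr_ge0.
Qed.

Lemma l2normZi m (t : R) (u : 'cV[C]_m) : l2norm (('i%C * t%:C%C) *: u) = `|t| * l2norm u.
Proof. by rewrite !l2normE sqnormZi sqrtrM ?sqr_ge0 // sqrtr_sqr. Qed.

Lemma l2norm_Imvec_eq1 u : l2norm u = 1 ->
  (l2norm (Imvec (B^t* *m u)) = 1 <->
   u = ('i%C / (l2norm x0)%:C%C) *: x0 \/ u = - (('i%C / (l2norm x0)%:C%C) *: x0)).
Proof.
move=> u1; rewrite -{1}u1.
have n0 : 0 < l2norm x0 by rewrite lt_def l2norm_eq0 x0n l2norm_ge0.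
have invE : 'i%C / (l2norm x0)%:C%C = 'i%C * ((l2norm x0)^-1)%:C%C :> C.
  by rewrite fmorphV.
split => [/l2norm_Imvec_eq [t ut]|].
  have : `|t| = (l2norm x0)^-1.
    apply: (mulIf (lt0r_neq0 n0)); rewrite mulVf ?lt0r_neq0 //.
    by rewrite -l2normZi -ut.
  rewrite invE ut; have [_ ->|_ <-] := ger0P t; first by left.
  by right; rewrite rmorphN mulrN scaleNr opprK.
rewrite invE -scaleNr -mulrN -rmorphN.
by case=> ->; exact: l2norm_Imvec_x0.
Qed.

(** A maximiser of value 1 would be a real multiple of [i x0], against its orthogonality to [i x0].
    The constraint set is nonempty because it contains [x0]. *)
Lemma lambda2_maximum : exists2 lambda2 : R,
  is_maximum (lambda2_values c mu x0) lambda2 & lambda2 < 1.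
Proof.
have rdot_i (t : R) : rdot (('i%C * t%:C%C) *: x0) ('i%C *: x0) = t * sqnorm x0.
  rewrite rdotE /sqnorm big_distrr; apply: eq_bigr => k _ /=.
  by rewrite !mxE; case: (x0 k 0) => a b /=; ring.
have x0i : rdot x0 ('i%C *: x0) = 0.
  rewrite rdotE big1 // => k _; rewrite !mxE; case: (x0 k 0) => a b /=; ring.
have [u [un ui] umax] := max_Imvec_quotient (B^t*) x0n x0i.
exists ((l2norm u)^-1 * l2norm (Imvec (B^t* *m u))).
  split; first by exists u.
  by move=> _ [u' [u'n u'i] <-]; exact: umax.
have n0 : 0 < l2norm u by rewrite lt_def l2norm_eq0 un l2norm_ge0.
rewrite mulrC ltr_pdivrMr // mul1r lt_def l2norm_Imvec_le andbT.
apply/eqP => /esym /l2norm_Imvec_eq [t ut].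
move: ui; rewrite ut rdot_i => /eqP; rewrite mulf_eq0 sqnorm_eq0 (negPf x0n) orbF.
by move=> /eqP t0; move: un; rewrite ut t0 mulr0 scale0r eqxx.
Qed.

End Deterministic.

(** * From phase conditions on [B] to uniqueness *)

Section Uniqueness.
Variables (R : realType) (d : nat) (M : 'I_d -> nat) (l : nat) (c : R[i]).
Variables (mu : 'I_l -> box M -> R[i]) (x0 : 'cV[R[i]]_#|box M|).
Local Notation C := R[i].
Local Notation Re := (@complex.Re R).
Local Notation A := (Amat c mu).
Local Notation B := (Bmat c mu x0).
Hypothesis hA : A *m A^t* = 1%:M.
Hypothesis mu1 : forall i p, `|mu i p| = 1.

Definition on_box (u : 'cV[C]_#|box M|) (p : box M) : C := u (enum_rank p) 0.

Lemma Astar_apply i (k : freq_box M) u :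
  (Astar c mu *m u) (tagnat.Rank i (enum_rank k)) 0 =
  c * dft (fun p => mu i p * on_box u p) k.
Proof.
have E : submxcol (Astar c mu *m u) i = c *: (oversampled_dft M *m diag_mask (mu i) *m u).
  have Z (X : 'cV[C]_(\sum_(j < l) #|freq_box M|)) :
      submxcol (c *: X) i = c *: submxcol X i by apply/matrixP => a b; rewrite !mxE.
  by rewrite /Astar -scalemxAl mxcol_mul Z mxcolK.
transitivity (submxcol (Astar c mu *m u) i (enum_rank k) 0); first by rewrite [RHS]mxE.
rewrite E mxE; congr (_ * _); rewrite mxE /dft.
rewrite [RHS](reindex (fun k : 'I_#|box M| => enum_val k)) /=; last first.
  by exists enum_rank => m _; rewrite ?enum_valK ?enum_rankK.
apply: eq_bigr => m _; rewrite mul_mx_diag !mxE /on_box enum_valK enum_rankK.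
rewrite -mulrA mulrC; congr (_ * _); rewrite /wave -expi_sum; congr expi.
by rewrite big_distrr /= -sumrN; apply: eq_bigr.
Qed.

Lemma c_neq0 : x0 != 0 -> c != 0.
Proof.
move=> x0n; apply: contraNneq x0n => c0; rewrite -sqnorm_eq0.
have iA : (Astar c mu)^t* *m Astar c mu = 1%:M by move: hA; rewrite /Amat conjmxK.
by rewrite -(isometry_sqnorm x0 iA) /Astar c0 scale0r mul0mx sqnorm_eq0.
Qed.

Lemma phase_unique (i j : 'I_l) : (2 <= object_rank x0)%N ->
  (forall s q p1 p2, s != q -> ~ (p1 = s /\ p2 = q) -> ~ (p1 = q /\ p2 = s) ->
    mu j p1 * mu j p2 * (mu j s * mu j q)^* !=
    mu i p1 * mu i p2 * (mu i s * mu i q)^*) ->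
  x0 != 0 /\ forall u, (forall k, Re ((B^t* *m u) k 0) = 0) ->
    exists t : R, u = ('i%C * t%:C%C) *: x0.
Proof.
move=> rk gen.
have [r0 [xr0 _ _]] := object_rank_third_point 0 0 rk.
have x0n : x0 != 0 by apply: contraNneq xr0 => ->; rewrite mxE.
split=> // u hu.
have cn := c_neq0 x0n.
(* The factor [- 'i] turns purely imaginary products into real ones, the symmetry that [corr_unique]
   expects. *)
pose x := on_box x0; pose y p := - 'i%C * on_box u p.
have xr0' : x (enum_val r0) != 0 by rewrite /x /on_box enum_valK.
have [s xs ts] := exists_top xr0'; have [q xq bq] := exists_bot xr0'.
have [r [xr rs rq]] := object_rank_third_point (box_point s) (box_point q) rk.
have {}xr : x (enum_val r) != 0 by rewrite /x /on_box enum_valK.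
have {}rs : enum_val r != s by apply/eqP => e; apply: rs; rewrite e.
have {}rq : enum_val r != q by apply/eqP => e; apply: rq; rewrite e.
(* If top and bottom coincided, every support point would have their weight, and the third point
   would equal [s]. *)
have sq : s != q.
  apply: contraNneq rs => sq; apply/eqP/weight_inj/eqP.
  by rewrite eqn_leq ts // sq bq.
have H m : corr (fun p => mu m p * y p) (fun p => (mu m p * x p)^*) =2
    corr (fun p => mu m p * x p) (fun p => (mu m p * y p)^*).
  apply: (corr_of_dft (b := fun p => mu m p * x p) (e := fun p => mu m p * y p)) => k.
  have yE : dft (fun p => mu m p * y p) k = - 'i%C * dft (fun p => mu m p * on_box u p) k.
    by rewrite /dft big_distrr; apply: eq_bigr => p _ /=; rewrite /y; ring.
  have := hu (tagnat.Rank m (enum_rank k)); rewrite Bmat_apply !Astar_apply => /Re_phase.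
  rewrite yE -/x; set U := dft _ k; set X := dft _ k => h.
  have {}h : U * X^* + X * U^* = 0.
    apply: (mulfI (mulf_neq0 cn (_ : c^* != 0))); first by rewrite conjC_eq0.
    by rewrite mulr0 -[RHS]h !rmorphM /=; ring.
  have ci : (- 'i%C : C)^* = 'i%C by apply/eqP; rewrite eq_complex /= oppr0 opprK !eqxx.
  have ringE (I a b e f : C) : - I * a * e - b * (I * f) = - I * (a * e + b * f) by ring.
  by rewrite rmorphM /= ci; apply/eqP; rewrite -subr_eq0 ringE h mulr0.
pose m2 (b : bool) := if b then mu j else mu i.
have m2n b p : `|m2 b p| = 1 by case: b; exact: mu1.
have H2 b : corr (fun p => m2 b p * y p) (fun p => (m2 b p * x p)^*) =2
    corr (fun p => m2 b p * x p) (fun p => (m2 b p * y p)^*) by case: b; exact: H.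
have [t tt yt] := corr_unique m2n H2 xs xq xr ts bq rs rq (fun p1 p2 => gen s q p1 p2 sq).
exists (Re t); rewrite -conjC_real //; apply/colP => k.
have := yt (enum_val k); rewrite /y /x /on_box enum_valK mxE => e.
by rewrite -mulrA -e mulrA mulrN -expr2 sqr_i opprK mul1r.
Qed.

End Uniqueness.

(** * Almost sure genericity and the conclusion *)

Local Open Scope complex_scope.

Theorem theorem5p3 (R : realType) (dO : measure_display) (Om : measurableType dO)
  (P : probability Om R) (d : nat) (M : 'I_d -> nat) (l : nat) (c : R[i])
  (mu : 'I_l -> Om -> box M -> R[i]) (x0 : 'cV[R[i]]_#|box M|)
  (hd : (2 <= d)%N) (hl : (2 <= l)%N)
  (hx0 : (2 <= object_rank x0)%N)
  (hmu : forall j, random_phase_mask (mu j))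
  (hrand : exists j : 'I_l,
     independently_continuously_distributed P (mu j) /\
     independent_events P (sigma_masks mu [set j]) (sigma_masks mu [set~ j]))
  (hA : forall w, let A := Amat c (fun j => mu j w) in A *m A^t* = 1%:M) :
  {ae P, forall w,
    let B := Bmat c (fun j => mu j w) x0 in
    (forall u : 'cV[R[i]]_#|box M|, l2norm u = 1 ->
       (l2norm (Imvec (B^t* *m u)) = 1 <->
        u = ('i / (l2norm x0)%:C) *: x0 \/ u = - (('i / (l2norm x0)%:C) *: x0))) /\
    (exists2 lambda2 : R,
       is_maximum (lambda2_values c (fun j => mu j w) x0) lambda2 &
       lambda2 < 1)}.
Proof.
have [j [[phi [cphi iphi muphi]] ind]] := hrand.
have [i ij] : exists i : 'I_l, i != j.
  have [j0|j0] := eqVneq (j : nat) 0%N.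
    by exists (Ordinal hl); rewrite -val_eqE /= j0.
  by exists (Ordinal (ltnW hl)); rewrite -val_eqE /= eq_sym.
(* Quadruples of box points form a finite type, so the exceptional events have a null union. *)
pose generic (z : box M * box M * box M * box M) : set Om := [set w |
  let '(s, q, p1, p2) := z in
  s != q -> ~ (p1 = s /\ p2 = q) -> ~ (p1 = q /\ p2 = s) ->
  mu j w p1 * mu j w p2 * (mu j w s * mu j w q)^*%R !=
  mu i w p1 * mu i w p2 * (mu i w s * mu i w q)^*%R].
have gen z : almost_everywhere P (generic z).
  case: z => [[[s q] p1] p2].
  have [sq|sq] := eqVneq s q; last have [n1|n1] := pselect (p1 = s /\ p2 = q);
    last have [n2|n2] := pselect (p1 = q /\ p2 = s).
  1-3: by apply: aeW => w /=; rewrite ?sq ?eqxx.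
  apply: negligibleS (mask_relation_negligible hmu cphi iphi muphi ind ij sq n1 n2).
  by move=> w /= h; apply: contrapT => /eqP ne; apply: h.
have fP : Filter (almost_everywhere P) by exact: ae_filter_ringOfSetsType.
have G := filter_forall fP gen.
apply: filterS G => w Gw.
have mu1 k p : `|mu k w p| = 1 by have [h _] := hmu k; exact: h.
have [x0n uniq] := @phase_unique _ _ _ _ c (fun k => mu k w) x0 (hA w) mu1 i j hx0
  (fun s q p1 p2 => Gw (s, q, p1, p2)).
split=> [u u1|]; first exact: l2norm_Imvec_eq1.
exact: lambda2_maximum.
Qed.
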